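(* For any swap dynamics $M\in\mathcal{M}_2$, the price of anarchy with respect to the minimum rank, $\mathit{PoA}_{mrk}(M)$, is $\Theta(n)$ in the single-peaked domain, where $n$ is the number of agents.
   Context: Housing market: an instance is $I=\langle \mathcal{N},\mathcal{R},L,\pi^0\rangle$ with $\mathcal{N}=\{a_1,\dots,a_n\}$ a set of $n$ agents, $\mathcal{R}=\{r_1,\dots,r_n\}$ a set of $n$ resources, $L$ a profile of strict linear orders $\succ_i$ over $\mathcal{R}$, one for each agent $a_i$, and $\pi^0$ an initial allocation; an allocation $\pi$ is a bijective assignment of one resource $\pi_{a_i}$ to each agent $a_i$. The instance is single-peaked if there is a linear order $\lhd$ over $\mathcal{R}$ such that for every agent $a_i$ with top resource $t_i$ and all resources $r,r'$, if $r'\lhd r\lhd t_i$ or $t_i\lhd r\lhd r'$ then $r\succ_i r'$. Ranks: $rank_{a_i}(r)\in\{1,\dots,n\}$ is such that $a_i$'s most preferred resource has rank $n$, the second most preferred $n-1$, ..., the least preferred $1$. The minimum rank is $mrk(\pi)=\min_{a_i\in\mathcal{N}}rank_{a_i}(\pi_{a_i})$. Swap dynamics: a swap-deal between two distinct agents exchanges the resources they currently hold; it is improving if both strictly prefer the resource they receive. A swap dynamics is determined by a selection heuristic, which at each round proposes a swap-deal (a pair of agents), possibly depending on the history and on the preferences, possibly randomly. Starting from $\pi^0$, the proposed deal is implemented (successful) if it is improving and refused otherwise. The heuristic has full coverage if for any two agents $a_x,a_y$ the deal $\langle a_x,a_y\rangle$ is proposed at some round, and, if there are successful swap-deals involving $a_x$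 or $a_y$, at some round after the latest one. The process terminates when every pair $a_x,a_y$ has been unsuccessfully proposed at a round after which no successful deal involved $a_x$ or $a_y$; thus the final allocation is reached from $\pi^0$ by improving swap-deals and admits no improving swap-deal. $\mathcal{M}_2$ is the family of swap dynamics whose selection heuristic has full coverage; they are defined for all $n$. $M(I)$ is the (nonempty) set of allocations that $M$ may return on $I$. Price of anarchy: $\mathit{PoA}_{mrk}(M)=\max_{I}\dfrac{\max_{\pi}mrk(\pi)}{\min_{\pi\in M(I)}mrk(\pi)}$, viewed as a function of $n$, where $I$ ranges over the single-peaked instances with $n$ agents and, in the numerator, $\pi$ ranges over all allocations of $I$. *)

(* Defs.v *)
From HB Require Import structures.
From mathcomp Require Import all_boot all_order all_algebra all_fingroup.
From mathcomp Require Import all_classical all_reals all_analysis.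

Set Implicit Arguments.
Unset Strict Implicit.
Unset Printing Implicit Defensive.

Import Order.TTheory GRing.Theory Num.Theory.
Import numFieldNormedType.Exports.

Local Open Scope classical_set_scope.
Local Open Scope ring_scope.

Definition strict_linear_order (T : eqType) (e : rel T) : Prop :=
  [/\ irreflexive e, transitive e & forall x y, x != y -> e x y || e y x].

(* Agents and resources are both indexed by 'I_n, so that an allocation, a
   bijection from agents to resources, is a permutation of 'I_n. *)
Definition agent (n : nat) := 'I_n.
Definition resource (n : nat) := 'I_n.
Definition allocation (n : nat) := {perm 'I_n}.

(* [prefers I i r r'] : agent i strictly prefers r to r'. *)
Record instance (n : nat) := Instance {
  prefers : agent n -> rel (resource n);
  initial : allocation n;
  prefersP : forall i, strict_linear_order (prefers i)
}.

Definition is_top n (I : instance n) (i : agent n) (t : resource n) : Prop :=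
  forall r : resource n, r != t -> prefers I i t r.

(* [lt r r'] : r is to the left of r' on the axis. *)
Definition single_peaked n (I : instance n) : Prop :=
  exists lt : rel (resource n), strict_linear_order lt /\
    forall (i : agent n) (t r r' : resource n), is_top I i t ->
      (lt r' r /\ lt r t) \/ (lt t r /\ lt r r') -> prefers I i r r'.

Definition rank n (I : instance n) (i : agent n) (r : resource n) : nat :=
  #|[set r' : resource n | prefers I i r r']%SET|.+1.

(* Ranks are at most n, so the default value n is neutral for the minimum. *)
Definition mrk n (I : instance n) (pi : allocation n) : nat :=
  \big[minn/n]_(i < n) rank I i (pi i).

(* A deal is encoded as an ordered pair, but (x, y) and (y, x) are the same
   deal: see [between]. *)
Definition deal (n : nat) := {p : 'I_n * 'I_n | p.1 != p.2}.

Definition involves n (d : deal n) (x : agent n) : bool :=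
  (x == (val d).1) || (x == (val d).2).

Definition between n (d : deal n) (x y : agent n) : bool :=
  (val d == (x, y)) || (val d == (y, x)).

Definition improving n (I : instance n) (pi : allocation n) (d : deal n) :
    bool :=
  let: (x, y) := val d in
  prefers I x (pi y) (pi x) && prefers I y (pi x) (pi y).

Definition swap n (pi : allocation n) (d : deal n) : allocation n :=
  (tperm (val d).1 (val d).2 * pi)%g.

Section Runs.
Variables (n : nat) (I : instance n).

(* A run is the sequence of the proposals made at rounds 0, 1, 2, ...; None
   means that nothing is proposed, see [select_deal]. *)
Variable run : nat -> option (deal n).

(* The allocation held just before round t. *)
Fixpoint held (t : nat) : allocation n :=
  if t is s.+1 then
    if run s is Some d then
      if improving I (held s) d then swap (held s) d else held s
    else held s
  else initial I.

Definition proposed (x y : agent n) (t : nat) : Prop :=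
  exists2 d, run t = Some d & between d x y.

Definition successful (t : nat) : Prop :=
  exists2 d, run t = Some d & improving I (held t) d.

Definition success_involving (x y : agent n) (t : nat) : Prop :=
  exists d, [/\ run t = Some d, improving I (held t) d
              & involves d x || involves d y].

Definition covers_all_pairs : Prop :=
  forall x y : agent n, x != y -> exists t, proposed x y t /\
    forall s, success_involving x y s -> (s < t)%N.

(* The process is over when rounds 0, ..., T - 1 have been played. *)
Definition terminated (T : nat) : Prop :=
  forall x y : agent n, x != y -> exists t,
    [/\ (t < T)%N, proposed x y t, ~ successful t
      & forall s, (t < s < T)%N -> ~ success_involving x y s].

(* Once the process is over no proposal is improving any more, so that pi does
   not depend on the choice of T. *)
Definition returns (pi : allocation n) : Prop :=
  exists T, terminated T /\ held T = pi.

End Runs.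

(* The randomness of the selection heuristic is carried by a seed drawn once
   and for all; a deterministic heuristic is one that ignores the seed. The
   history is the list of past proposals, oldest first: together with the
   instance it determines which of them were successful and the allocation
   currently held. There is no pair of distinct agents when n <= 1, hence the
   option in [select]. *)
Record swap_dynamics (R : realType) := SwapDynamics {
  seed_display : measure_display;
  seed : measurableType seed_display;
  seed_law : probability seed R;
  select : forall n, instance n -> seed -> seq (option (deal n)) ->
           option (deal n);
  select_deal : forall n (I : instance n) w h,
    (1 < n)%N -> exists d, select I w h = Some d;
  select_measurable : forall n (I : instance n) h o,
    measurable [set w | select I w h = o]
}.

Section Dynamics.
Variables (R : realType) (M : swap_dynamics R).

Fixpoint history n (I : instance n) (w : seed M) (t : nat) :
    seq (option (deal n)) :=
  if t is s.+1 then
    rcons (history I w s) (select I w (history I w s))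
  else [::].

Definition run_of n (I : instance n) (w : seed M) (t : nat) :
    option (deal n) :=
  select I w (history I w t).

Definition full_coverage : Prop :=
  forall n (I : instance n),
    {ae seed_law M, forall w, covers_all_pairs I (run_of I w)}.

Definition may_return n (I : instance n) (pi : allocation n) : bool :=
  (0 < seed_law M [set w | returns I (run_of I w) pi])%E.

Definition outcomes n (I : instance n) : {set allocation n} :=
  [set pi | may_return I pi]%SET.

Definition max_mrk n (I : instance n) : nat :=
  \max_(pi : allocation n) mrk I pi.

(* mrk is at most n, so the default value n is neutral for the minimum over the
   nonempty set of outcomes. *)
Definition min_outcome_mrk n (I : instance n) : nat :=
  \big[minn/n]_(pi in outcomes I) mrk I pi.

(* For each n there are finitely many instances, up to extensional equality of
   the preferences, so that the supremum is a maximum. *)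
Definition PoA_mrk (n : nat) : R :=
  sup [set (max_mrk I)%:R / (min_outcome_mrk I)%:R
      | I in [set I : instance n | single_peaked I]].

End Dynamics.

(* Main.v *)
(* Ranks lie between 1 and n, whence the upper bound n. For the lower bound,
   start from an allocation that admits no improving swap, so that any dynamics
   with full coverage returns it almost surely: all agents but one hold their
   favourite resource, and the remaining one holds the resource it likes least,
   at one end of the axis, while it wants the other end. A cyclic shift of the
   resources along the axis has minimum rank at least n - 1. *)

Require Import Defs.
From mathcomp Require Import all_boot all_order all_algebra.
From mathcomp Require Import all_classical all_reals all_analysis.
From mathcomp Require Import perm zify.
Set Implicit Arguments.
Unset Strict Implicit.
Unset Printing Implicit Defensive.

Import Order.TTheory GRing.Theory Num.Theory.
Import numFieldNormedType.Exports.
Local Open Scope classical_set_scope.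
Local Open Scope ring_scope.

(** * Elementary bounds on minimum ranks *)

Lemma leq_bigminn (I : finType) (P : pred I) (F : I -> nat) x m :
  (m <= x)%N -> (forall i, P i -> (m <= F i)%N) ->
  (m <= \big[minn/x]_(i | P i) F i)%N.
Proof. by rewrite -minEnat -leEnat; exact: le_bigmin. Qed.

Lemma bigminn_leq_id (I : finType) (P : pred I) (F : I -> nat) x :
  (\big[minn/x]_(i | P i) F i <= x)%N.
Proof. by rewrite -minEnat -leEnat; exact: bigmin_le_id. Qed.

Lemma bigminn_leq_cond (I : finType) (P : pred I) (F : I -> nat) x j :
  P j -> (\big[minn/x]_(i | P i) F i <= F j)%N.
Proof. by rewrite -minEnat -leEnat; exact: bigmin_le_cond. Qed.

Lemma mrk_le n (I : instance n) (pi : allocation n) : (mrk I pi <= n)%N.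
Proof. exact: bigminn_leq_id. Qed.

Lemma mrk_gt0 n (I : instance n) (pi : allocation n) :
  (0 < n)%N -> (0 < mrk I pi)%N.
Proof. by move=> n0; exact: leq_bigminn. Qed.

Lemma max_mrk_le n (I : instance n) : (max_mrk I <= n)%N.
Proof. by apply/bigmax_leqP => pi _; exact: mrk_le. Qed.

Lemma min_outcome_mrk_gt0 (R : realType) (M : swap_dynamics R) n
  (I : instance n) : (0 < n)%N -> (0 < min_outcome_mrk M I)%N.
Proof.
by move=> n0; apply: leq_bigminn => // pi _; exact: mrk_gt0.
Qed.

(** * Runs from a stable initial allocation *)

Definition stable n (I : instance n) (pi : allocation n) : Prop :=
  forall d, ~~ improving I pi d.

Lemma held_stable n (I : instance n) run t :
  stable I (initial I) -> held I run t = initial I.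
Proof.
move=> st; elim: t => //= t ->; case: (run t) => // d.
by rewrite (negbTE (st d)).
Qed.

(** No proposal ever succeeds here, so termination only asks that each of the finitely many pairs be
    proposed. *)
Lemma returns_stable n (I : instance n) run :
  stable I (initial I) ->
  returns I run (initial I) <->
  forall xy : 'I_n * 'I_n, xy.1 != xy.2 -> exists t, proposed run xy.1 xy.2 t.
Proof.
move=> st; have fail t d : ~~ improving I (held I run t) d.
  by rewrite held_stable.
split=> [[T [term _]] [x y] /= xy|prop].
  by have [t [_ ? _ _]] := term _ _ xy; exists t.
have /choice[f fP] : forall xy : 'I_n * 'I_n, exists t,
    xy.1 != xy.2 -> proposed run xy.1 xy.2 t.
  (* Diagonal pairs get the dummy round 0. *)
  move=> xy; have [_|/prop[t]] := eqVneq xy.1 xy.2; first by exists 0%N.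
  by exists t.
exists (\max_xy f xy).+1; split; last exact: held_stable.
move=> x y xy; exists (f (x, y)); split.
- by rewrite ltnS leq_bigmax.
- exact: (fP (x, y)).
- by case=> d _; apply/negP.
- by move=> s _ [d [_ + _]]; apply/negP.
Qed.

(** * Measurability of the return event *)

Section Measurability.
Variables (R : realType) (M : swap_dynamics R) (n : nat) (I : instance n).

Lemma measurable_history t h : measurable [set w : seed M | history I w t = h].
Proof.
elim: t h => [|t IH] h /=.
  have [<-|h0] := eqVneq [::] h.
    by rewrite (_ : [set _ | _] = setT) //; apply/seteqP; split.
  rewrite (_ : [set _ | _] = set0) //; apply/seteqP; split=> // w /=.
  exact/eqP.
case: (lastP h) => [|h' o].
  rewrite (_ : [set _ | _] = set0) //; apply/seteqP; split=> // w /=.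
  by case: (history I w t).
rewrite (_ : [set _ | _] =
  [set w | history I w t = h'] `&` [set w | select I w h' = o]).
  by apply: measurableI => //; exact: select_measurable.
apply/seteqP; split=> w /=.
  by move=> /rcons_inj[<- <-].
by case=> -> ->.
Qed.

(** Histories form a countable type, so the event splits into countably many pieces on which the
    history is fixed. *)
Lemma measurable_run_of t o : measurable [set w : seed M | run_of I w t = o].
Proof.
rewrite (_ : [set _ | _] = \bigcup_(h : seq (option (deal n)))
  ([set w | history I w t = h] `&` [set w | select I w h = o])).
  apply: countable_bigcupT_measurable => [|h]; first exact: countableP.
  apply: measurableI; [exact: measurable_history|exact: select_measurable].
apply/seteqP; split=> w /=; first by exists (history I w t).
by case=> h _ [<-].
Qed.

Lemma measurable_proposed x y t :
  measurable [set w : seed M | proposed (run_of I w) x y t].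
Proof.
rewrite (_ : [set _ | _] = \bigcup_(d in [set d : deal n | between d x y])
  [set w | run_of I w t = Some d]).
  rewrite bigcup_mkcond; apply: countable_bigcupT_measurable => [|d].
    exact: countableP.
  by case: ifP => // _; exact: measurable_run_of.
by apply/seteqP; split=> w /= [d]; exists d.
Qed.

Lemma measurable_returns_stable : stable I (initial I) ->
  measurable [set w : seed M | returns I (run_of I w) (initial I)].
Proof.
move=> st; rewrite (_ : [set _ | _] =
  \bigcap_(xy in [set xy : 'I_n * 'I_n | xy.1 != xy.2])
  \bigcup_t [set w | proposed (run_of I w) xy.1 xy.2 t]).
  apply: fin_bigcap_measurable => // xy _.
  by apply: bigcupT_measurable => t; exact: measurable_proposed.
apply/seteqP; split=> w /=.
  by move=> /(returns_stable _ st) H xy /H[t]; exists t.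
by move=> H; apply/(returns_stable _ st) => xy /H[t _]; exists t.
Qed.

(** Covering all pairs forces the return of a stable start, so the complement of [B] is negligible;
    as [B] is measurable, it has probability one. *)
Lemma may_return_stable : full_coverage M -> stable I (initial I) ->
  may_return M I (initial I).
Proof.
move=> cov st; have mB := measurable_returns_stable st.
set B := [set w | _] in mB.
have : (seed_law M).-negligible (~` B).
  have [A [mA A0 sub]] := cov n I.
  exists A; split=> // w nBw; apply: sub => /= Cw; apply: nBw.
  apply/(returns_stable _ st) => -[x y] /= /Cw[t [? _]].
  by exists t.
move=> /(measure_negligible (measurableC mB)).
move=> B1; have := probability_setC (seed_law M) mB.
rewrite B1 /may_return -/B => {}B1.
rewrite lt0e measure_ge0 andbT; apply/eqP => B0.
by move: B1; rewrite B0 sube0 => /esym/eqP; rewrite onee_eq0.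
Qed.

End Measurability.

(** * Single-peaked instances with prescribed peaks *)

Section PeakedInstance.
Variable n : nat.

(* An order that is single-peaked at p on the axis 0, ..., n - 1: from best to
   worst, p, p - 1, ..., 0, p + 1, ..., n - 1. The penalty is the position in
   this list. *)
Definition penalty (p r : 'I_n) : nat := if (r <= p)%N then (p - r)%N else r.

Lemma penalty_inj p : injective (penalty p).
Proof.
move=> r r'; rewrite /penalty => H; apply/val_inj => /=.
by move: H; case: ifP => ?; case: ifP => ?; lia.
Qed.

Lemma penalty_lt p r : (penalty p r < n)%N.
Proof.
have := ltn_ord r; have := ltn_ord p.
by rewrite /penalty; case: ifP => ?; lia.
Qed.

Lemma penalty_order p :
  strict_linear_order (fun r r' => penalty p r < penalty p r')%N.
Proof.
split=> [r|r1 r2 r3|x y xy]; first exact: ltnn.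
  exact: ltn_trans.
rewrite -neq_ltn; apply: contraNneq xy => /penalty_inj ->.
by rewrite eqxx.
Qed.

Definition peaked_instance (p : 'I_n -> 'I_n) (pi : allocation n) :
    instance n :=
  @Instance n (fun i r r' => penalty (p i) r < penalty (p i) r')%N pi
    (fun i => penalty_order (p i)).

Lemma peaked_instance_single_peaked p pi : single_peaked (peaked_instance p pi).
Proof.
exists (fun r r' : 'I_n => r < r')%N; split.
  split=> [r|r1 r2 r3|x y]; [exact: ltnn|exact: ltn_trans|].
  by rewrite -neq_ltn.
move=> i t r r' top_t.
have -> : t = p i.
  (* The peak has penalty 0, so no resource is preferred to it. *)
  apply/esym/eqP/negP => /negP /top_t /=.
  by rewrite /penalty leqnn subnn.
by rewrite /= /penalty; case: ifP => ?; case: ifP => ?; lia.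
Qed.

Lemma rank_peaked_instance p pi i r :
  rank (peaked_instance p pi) i r = (n - penalty (p i) r)%N.
Proof.
rewrite /rank /=.
(* Penalties are distinct and below n, so [f] permutes the indices and counting worse resources
   amounts to counting indices above a given penalty. *)
pose f r := Ordinal (penalty_lt (p i) r).
have f_inj : injective f by move=> x y [] /penalty_inj.
rewrite (_ : finset _ = f @^-1: [set j : 'I_n | penalty (p i) r < j]%SET)%N;
  last by apply/setP => j; rewrite !inE.
rewrite card_preimset // -sum1_card.
under eq_bigl do rewrite inE.
rewrite -(big_geq_mkord (penalty (p i) r).+1 n xpredT (fun=> 1%N)).
rewrite sum_nat_const_nat muln1.
have := penalty_lt (p i) r; lia.
Qed.

End PeakedInstance.

(* Agent 0 wants the resource n at the far end of the axis, every other agent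
   holds its favourite resource, and agent 0 holds the one it likes least. *)
Definition bad_peak n (i : 'I_n.+1) : 'I_n.+1 :=
  if i == ord0 then ord_max else i.

Definition bad_instance n : instance n.+1 := peaked_instance (@bad_peak n) 1%g.

(** Any deal involves an agent other than 0, which already holds its peak and refuses. *)
Lemma bad_instance_stable n : stable (bad_instance n) (initial (bad_instance n)).
Proof.
have top (x y : 'I_n.+1) : x != ord0 -> ~~ prefers (bad_instance n) x y x.
  by move=> /negbTE x0; rewrite /= /bad_peak x0 /penalty leqnn subnn ltn0.
case=> -[x y] /= xy; rewrite /improving /= !perm1.
have [x0|x0] := eqVneq x ord0; last by rewrite negb_and top.
by rewrite negb_and orbC top // -x0 eq_sym.
Qed.

Lemma mrk_bad_initial n :
  (mrk (bad_instance n) (initial (bad_instance n)) <= 1)%N.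
Proof.
apply: leq_trans (@bigminn_leq_cond _ xpredT _ _ ord0 isT) _.
rewrite rank_peaked_instance /= perm1 /bad_peak eqxx /penalty /=.
by lia.
Qed.

(* Shifting all resources by one position costs one rank to agents 1, ..., n
   and gives agent 0 its favourite resource. *)
Lemma max_mrk_bad n : (n <= max_mrk (bad_instance n))%N.
Proof.
(* [s] is i - 1 modulo n + 1: agent 0 wraps around to resource n, the others incur penalty 1. *)
pose s : allocation n.+1 := perm (can_inj (@ord_predK n.+1)).
apply: leq_trans (leq_bigmax s).
apply: leq_bigminn => [|i _]; first exact: leqnSn.
rewrite rank_peaked_instance permE /bad_peak /penalty /=.
have := ltn_ord i; case: eqVneq => [->|i0] /=.
  by rewrite modn_small // leqnn; lia.
have i1 : (0 < i)%N by rewrite lt0n.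
rewrite (_ : (i + n.+1).-1 = i.-1 + n.+1)%N; last by lia.
rewrite modnDr modn_small; last by have := ltn_ord i; lia.
by case: ifP => ?; lia.
Qed.

(** * The two bounds on the price of anarchy *)

Section PoABounds.
Variables (R : realType) (M : swap_dynamics R).

Let ratios n : set R := [set (max_mrk I)%:R / (min_outcome_mrk M I)%:R
      | I in [set I : instance n | single_peaked I]].

Lemma ratios_ubound n : ubound (ratios n.+1) n.+1%:R.
Proof.
move=> _ [I _ <-]; have m0 := @min_outcome_mrk_gt0 R M _ I (ltn0Sn n).
rewrite ler_pdivrMr ?ltr0n // -natrM ler_nat.
exact: leq_trans (max_mrk_le I) (leq_pmulr _ m0).
Qed.

Lemma ratios_bad n : ratios n.+1
  ((max_mrk (bad_instance n))%:R / (min_outcome_mrk M (bad_instance n))%:R).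
Proof.
exists (bad_instance n) => //; exact: peaked_instance_single_peaked.
Qed.

Lemma PoA_mrk_le n : PoA_mrk M n.+1 <= n.+1%:R.
Proof.
apply: ge_sup; last exact: ratios_ubound.
by eexists; exact: ratios_bad.
Qed.

Lemma PoA_mrk_ge n : full_coverage M -> n%:R <= PoA_mrk M n.+1.
Proof.
move=> cov; apply: le_trans; last first.
  apply: ub_le_sup (ratios_bad n).
  by exists n.+1%:R; exact: ratios_ubound.
(* The stable start is a possible outcome, and agent 0 has rank 1 in it. *)
have -> : min_outcome_mrk M (bad_instance n) = 1%N.
  apply/eqP; rewrite eqn_leq min_outcome_mrk_gt0 // andbT.
  apply: leq_trans (mrk_bad_initial n).
  apply: bigminn_leq_cond; rewrite inE.
  exact: (may_return_stable cov (@bad_instance_stable n)).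
by rewrite divr1 ler_nat max_mrk_bad.
Qed.

End PoABounds.

Theorem proposition9 (R : realType) (M : swap_dynamics R)
  (M_full_coverage : full_coverage M) :
  (PoA_mrk M : nat -> R^o) \is 'Theta_\oo (fun n : nat => n%:R : R^o).
Proof.
(* With n + 1 agents the bounds are n and n + 1, and (n + 1) / 2 <= n as soon as n >= 1, that is,
   from two agents on. *)
rewrite qualifE; apply/asboolP; exists (2^-1, 1) => /=.
  by rewrite ltr01 invr_gt0 ltr0n.
exists 2%N => // -[//|n] /= n1; rewrite /= in n1.
have lo := PoA_mrk_ge n M_full_coverage; have hi := PoA_mrk_le M n.
rewrite !ger0_norm //; last exact: le_trans lo.
split; last by rewrite mul1r.
apply: le_trans lo; rewrite mulrC ler_pdivrMr ?ltr0n // -natrM ler_nat; lia.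
Qed.
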